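(* Let $\mathfrak S$ be a semiperfect $*$-semigroup, let $T$ be a symmetric subset of $\mathfrak S$ (i.e. $T=T^*:=\{s^*\colon s\in T\}$) containing the set $\mathfrak S_{\mathfrak h}=\{s\in\mathfrak S\colon s=s^*\}$ of all Hermitian elements, and let $Y$ be a determining subset of $\mathfrak X_{\mathfrak S}$. Then for every function $\varphi\colon T\to\mathbb C$ the following four conditions are equivalent: (i) $\varphi$ extends to a positive definite function $\psi\colon\mathfrak S\to\mathbb C$; (ii) there is a positive measure $\mu$ on $\mathsf M_{\mathfrak S}$ such that $\varphi(s)=\int_{\mathfrak X_{\mathfrak S}}\hat s\,d\mu$ for all $s\in T$; (iii) $\Lambda_{\varphi}(p)\ge0$ for every $p\in\mathcal P_T(\mathfrak X_{\mathfrak S})$ such that $p(\chi)\ge0$ for all $\chi\in\mathfrak X_{\mathfrak S}$; (iv) $\Lambda_{\varphi,Y}(p)\ge0$ for every $p\in\mathcal P_T(Y)$ for which there exist finitely many functions $q_1,\dots,q_n\in\mathcal P(Y)$ such that $p(\chi)=\sum_{j=1}^n|q_j(\chi)|^2$ for all $\chi\in Y$.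
   Context: A $*$-semigroup is a semigroup $\mathfrak S$ (written multiplicatively) with an involution $s\mapsto s^*$ satisfying $(st)^*=t^*s^*$ and $(s^* )^*=s$. Let $\mathfrak S$ be a commutative $*$-semigroup with unit $\varepsilon$. A character of $\mathfrak S$ is a function $\chi\colon\mathfrak S\to\mathbb C$ with $\chi(st)=\chi(s)\chi(t)$, $\chi(s^* )=\overline{\chi(s)}$, $\chi(\varepsilon)=1$; $\mathfrak X_{\mathfrak S}$ is the set of all characters, and for $s\in\mathfrak S$, $\hat s\colon\mathfrak X_{\mathfrak S}\to\mathbb C$ is $\hat s(\chi)=\chi(s)$. A nonempty $Y\subset\mathfrak X_{\mathfrak S}$ is determining if the system $\{\hat s|_Y\}_{s\in\mathfrak S}$ is linearly independent in $\mathbb C^Y$ (if some determining $Y$ exists, then $\mathfrak X_{\mathfrak S}$ is itself determining). For nonempty $T\subset\mathfrak S$ and nonempty $Y\subset\mathfrak X_{\mathfrak S}$, $\mathcal P_T(Y)$ is the linear span of $\{\hat s|_Y\colon s\in T\}$ in $\mathbb C^Y$, and $\mathcal P(Y)=\mathcal P_{\mathfrak S}(Y)$. If $Y$ is determining and $\varphi\colon T\to\mathbb C$, then $\Lambda_{\varphi,Y}\colon\mathcal P_T(Y)\to\mathbb C$ is the unique linear functional with $\Lambda_{\varphi,Y}(\hat s|_Y)=\varphi(s)$ for all $s\in T$; $\Lambda_\varphi:=\Lambda_{\varphi,\mathfrak X_{\mathfrak S}}$. A function $\psi\colon\mathfrak S\to\mathbb C$ is positive definite if $\sum_{k,l=1}^m\psi(s_l^*s_k)\lambda_k\overline{\lambda_l}\ge0$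 for all $m\ge1$, $s_1,\dots,s_m\in\mathfrak S$, $\lambda_1,\dots,\lambda_m\in\mathbb C$. $\mathsf M_{\mathfrak S}$ is the smallest $\sigma$-algebra of subsets of $\mathfrak X_{\mathfrak S}$ making all $\hat s$, $s\in\mathfrak S$, measurable. A unital commutative $*$-semigroup $\mathfrak S$ is semiperfect if for every positive definite function $\psi\colon\mathfrak S\to\mathbb C$ there is a finite positive measure $\mu$ on $\mathsf M_{\mathfrak S}$ such that $\psi(s)=\int_{\mathfrak X_{\mathfrak S}}\hat s(\chi)\,\mu(d\chi)$ for all $s\in\mathfrak S$. All integrands are tacitly assumed to be summable. *)

(* Defs.v *)
From HB Require Import structures.
From mathcomp Require Import all_boot all_order all_algebra.
From mathcomp Require Import complex.
From mathcomp Require Import all_classical all_reals all_analysis.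
Set Implicit Arguments.
Unset Strict Implicit.
Unset Printing Implicit Defensive.
Import Order.TTheory GRing.Theory Num.Theory numFieldNormedType.Exports.
Local Open Scope classical_set_scope.
Local Open Scope ring_scope.

(* A unital *-semigroup is a [starMonoidType]: its operation [s^-1] in
   [group_scope] is only required to be an involutive antimorphism, so it plays
   the role of s |-> s^* (no inverse law is assumed). Complex numbers are R[i]
   over a realType R; [0 <= z] in R[i] means that z is real and nonnegative. *)

Section LinearSpan.
Variables (K : fieldType) (V : lmodType K).

Definition lspan (A : set V) : set V :=
  [set v | exists n (c : 'I_n -> K) (u : 'I_n -> V),
     (forall i, A (u i)) /\ v = \sum_(i < n) c i *: u i].

Definition linearly_independent (I : eqType) (v : I -> V) : Prop :=
  forall (r : seq I) (c : I -> K), uniq r ->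
    \sum_(i <- r) c i *: v i = 0 -> forall i, i \in r -> c i = 0.

Definition lspan_pred (A : set V) : {pred V} := [pred v | `[< lspan A v >]].

Lemma lspan_submod_closed (A : set V) : submod_closed (lspan_pred A).
Proof.
split.
  by apply/asboolP; exists 0, (fun=> 0), (fun=> 0); split=> [[]|];
    rewrite ?big_ord0.
move=> a u v /asboolP[n [c [x [Ax ->]]]] /asboolP[m [d [y [Ay ->]]]].
apply/asboolP; exists (n + m)%N.
exists (fun i =>
  match fintype.split i with inl j => a * c j | inr j => d j end).
exists (fun i => match fintype.split i with inl j => x j | inr j => y j end).
split=> [i|]; first by case: (fintype.split i).
rewrite big_split_ord scaler_sumr /=; congr (_ + _); apply: eq_bigr => i _.
  by rewrite (unsplitK (inl i)) scalerA.
by rewrite (unsplitK (inr i)).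
Qed.

HB.instance Definition _ (A : set V) :=
  GRing.isSubmodClosed.Build K V (lspan_pred A) (lspan_submod_closed A).

Record lspan_type (A : set V) :=
  LSpan { lspan_val : V; lspan_valP : lspan_pred A lspan_val }.
HB.instance Definition _ A := [isSub for @lspan_val A].
HB.instance Definition _ A := [Choice of lspan_type A by <:].
HB.instance Definition _ A := [SubChoice_isSubLmodule of lspan_type A by <:].

Lemma lspan_val_inj (A : set V) : injective (@lspan_val A).
Proof. exact: val_inj. Qed.

Lemma lspan_val_linear (A : set V) : linear (@lspan_val A).
Proof. by []. Qed.

HB.instance Definition _ (A : set V) :=
  GRing.isLinear.Build K (lspan_type A) V *:%R (@lspan_val A)
    (@lspan_val_linear A).

Lemma lspan_mem (A : set V) v : A v -> lspan_pred A v.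
Proof.
move=> Av; apply/asboolP; exists 1%N, (fun=> 1), (fun=> v); split=> //.
by rewrite big_ord1 scale1r.
Qed.

End LinearSpan.

Section Characters.
Variables (R : realType) (S : starMonoidType).

Record character := Character {
  char_fun :> S -> R[i];
  charM : forall s t, char_fun (s * t)%g = char_fun s * char_fun t;
  charV : forall s, char_fun s^-1%g = (char_fun s)^*%C;
  char1 : char_fun 1%g = 1 }.

Lemma trivial_charM (s t : S) : 1 = 1 * 1 :> R[i]. Proof. by rewrite mulr1. Qed.
Lemma trivial_charV (s : S) : 1 = 1^*%C :> R[i]. Proof. by rewrite rmorph1. Qed.
Definition trivial_character : character :=
  Character trivial_charM trivial_charV erefl.

HB.instance Definition _ := gen_eqMixin character.
HB.instance Definition _ := gen_choiceMixin character.
HB.instance Definition _ := isPointed.Build character trivial_character.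

(* R[i]^o carries the topology of the modulus. *)
Definition borelC : set (set R[i]) := <<s (open : set (set R[i]^o)) >>.

(* Sets of the form hat(s) @^-1` B with B Borel: the sigma-algebra they
   generate is the smallest one making every hat(s) measurable. *)
Definition char_cylinders : set (set character) :=
  \bigcup_s preimage_set_system setT (fun chi : character => chi s) borelC.

Definition charspace : Type := g_sigma_algebraType char_cylinders.

Definition hat (s : S) (chi : charspace) : R[i] := (chi : character) s.

Definition hat_on (Y : set charspace) (s : S) : Y -> R[i]^o :=
  fun chi => hat s (\val chi).
Arguments hat_on : clear implicits.

Definition determining (Y : set charspace) : Prop :=
  Y !=set0 /\ linearly_independent (hat_on Y).

(* The linear space P_T(Y), as a type with its lmodType structure. *)
Definition polyspace (T : set S) (Y : set charspace) :=
  lspan_type [set hat_on Y s | s in T].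

Definition poly_fun {T : set S} {Y : set charspace} (p : polyspace T Y)
    (chi : Y) : R[i] := (lspan_val p : Y -> R[i]^o) chi.

Lemma hat_on_poly (T : set S) (Y : set charspace) (s : T) :
  lspan_pred [set hat_on Y s | s in T] (hat_on Y (\val s)).
Proof. by apply: lspan_mem; exists (\val s) => //; exact: set_valP. Qed.

Definition poly_hat (T : set S) (Y : set charspace) (s : T) :
  polyspace T Y :=
  LSpan (hat_on_poly Y s).

Definition interpolates {T : set S} {Y : set charspace} (phi : T -> R[i])
    (L : {scalar polyspace T Y}) :=
  forall s : T, L (poly_hat Y s) = phi s.

(* When Y is determining there is exactly one interpolating functional (see
   Lambda_hat and Lambda_unique); the zero functional is a junk value. *)
Definition Lambda {T : set S} (Y : set charspace) (phi : T -> R[i]) :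
    {scalar polyspace T Y} :=
  if pselect (exists L : {scalar polyspace T Y}, interpolates phi L) is left ex
  then sval (cid ex) else \0%R.

Lemma polyspaceE {T : set S} {Y : set charspace} (p : polyspace T Y) :
  exists r : seq (R[i] * T), p = \sum_(x <- r) x.1 *: poly_hat Y x.2.
Proof.
have /asboolP[n [c [u [Tu pE]]]] := lspan_valP p.
have {}Tu i : {s : T | hat_on Y (\val s) = u i}.
  by apply: cid; case: (Tu i) => s Ts <-; exists (SigSub (mem_set Ts)).
exists [seq (c i, sval (Tu i)) | i <- enum 'I_n].
apply: lspan_val_inj; rewrite pE big_map big_enum linear_sum.
by apply: eq_bigr => i _; rewrite linearZ /= (svalP (Tu i)).
Qed.

Lemma Lambda_wd {T : set S} {Y : set charspace} (phi : T -> R[i])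
    (r : seq (R[i] * T)) : determining Y ->
  \sum_(x <- r) x.1 *: poly_hat Y x.2 = 0 -> \sum_(x <- r) x.1 * phi x.2 = 0.
Proof.
move=> [_ Yind] r0; pose c (t : S) := \sum_(x <- r | \val x.2 == t) x.1.
have cE (M : lmodType R[i]) (f : T -> M) : \sum_(x <- r) x.1 *: f x.2 =
    \sum_(s <- undup [seq x.2 | x <- r]) c (\val s) *: f s.
  transitivity (\sum_(s <- undup [seq x.2 | x <- r])
                  \sum_(x <- r | x.2 == s) x.1 *: f x.2); last first.
    apply: eq_bigr => s _; rewrite scaler_suml.
    by under [RHS]eq_bigl do rewrite val_eqE; apply: eq_bigr => x /eqP ->.
  rewrite (exchange_big_dep xpredT) //= !big_seq; apply: eq_bigr => x xr.
  rewrite big_mkcond (bigD1_seq x.2) ?undup_uniq ?mem_undup ?map_f //=.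
  by rewrite eqxx big1 ?addr0 // => s /negPf; rewrite eq_sym => ->.
have {}r0 : \sum_(t <- [seq \val s | s <- undup [seq x.2 | x <- r]])
    c t *: hat_on Y t = 0.
  rewrite big_map -(cE _ (fun s : T => hat_on Y (\val s))).
  transitivity (lspan_val (\sum_(x <- r) x.1 *: poly_hat Y x.2)); last first.
    by rewrite r0.
  by rewrite linear_sum; apply: eq_bigr => x _; rewrite linearZ.
have {}r0 := Yind _ _ _ r0.
rewrite (cE R[i]^o phi) big_seq big1 // => s sr; rewrite r0 ?scale0r ?map_f //.
by rewrite map_inj_uniq ?undup_uniq //; exact: val_inj.
Qed.

Lemma Lambda_unique {T : set S} {Y : set charspace} (phi : T -> R[i])
    (L L' : {scalar polyspace T Y}) :
  interpolates phi L -> interpolates phi L' -> L =1 L'.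
Proof.
move=> Lphi L'phi p; have [r ->] := polyspaceE p; rewrite !linear_sum /=.
by apply: eq_bigr => x _; rewrite !linearZ Lphi L'phi.
Qed.

Lemma Lambda_hat {T : set S} {Y : set charspace} (phi : T -> R[i]) :
  determining Y -> interpolates phi (Lambda Y phi).
Proof.
move=> Ydet; rewrite /Lambda; case: pselect => [ex|[]]; first exact: svalP.
pose rep (p : polyspace T Y) := sval (cid (polyspaceE p)).
have repP p : p = \sum_(x <- rep p) x.1 *: poly_hat Y x.2.
  exact: svalP (cid (polyspaceE p)).
pose L (p : polyspace T Y) : R[i] := \sum_(x <- rep p) x.1 * phi x.2.
have LE p (r : seq (R[i] * T)) : p = \sum_(x <- r) x.1 *: poly_hat Y x.2 ->
    L p = \sum_(x <- r) x.1 * phi x.2.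
  move=> pE; apply/eqP; rewrite -subr_eq0 -sumrN; apply/eqP.
  have := @Lambda_wd T Y phi (rep p ++ [seq (- x.1, x.2) | x <- r]) Ydet.
  rewrite !big_cat !big_map /= -repP => H.
  rewrite -[RHS]H; first by congr (_ + _); apply: eq_bigr => x _; rewrite mulNr.
  apply/eqP; rewrite addr_eq0 -sumrN {1}pE; apply/eqP.
  by apply: eq_bigr => x _; rewrite scaleNr opprK.
have Llin : scalar L.
  move=> a p q; rewrite (LE _ ([seq (a * x.1, x.2) | x <- rep p] ++ rep q)).
    rewrite big_cat big_map /= mulr_sumr; congr (_ + _).
    by apply: eq_bigr => x _; rewrite mulrA.
  rewrite big_cat big_map /= {1}(repP p) {1}(repP q) scaler_sumr; congr (_ + _).
  by apply: eq_bigr => x _; rewrite scalerA.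
pose LM := GRing.isLinear.Build _ _ _ _ L Llin.
pose LL : {scalar polyspace T Y} := HB.pack L LM.
exists LL => s; rewrite /= (LE _ [:: (1, s)]) big_seq1 /= ?mul1r //.
by rewrite scale1r.
Qed.

Definition positive_definite (psi : S -> R[i]) : Prop :=
  forall m (s : 'I_m -> S) (lam : 'I_m -> R[i]), (0 < m)%N ->
    0 <= \sum_(k < m) \sum_(l < m)
           psi ((s l)^-1 * s k)%g * lam k * (lam l)^*%C.

End Characters.

Arguments hat_on {R S} Y s chi.
Coercion poly_fun : polyspace >-> Funclass.

Section ComplexIntegral.
Context d (X : measurableType d) (R : realType).
Variable mu : {measure set X -> \bar R}.

Definition Cintegrable (f : X -> R[i]) : Prop :=
  mu.-integrable setT (fun x => (complex.Re (f x))%:E) /\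
  mu.-integrable setT (fun x => (complex.Im (f x))%:E).

Definition Cintegral (f : X -> R[i]) : R[i] :=
  Complex (\int[mu]_x complex.Re (f x)) (\int[mu]_x complex.Im (f x)).

End ComplexIntegral.

Definition semiperfect (R : realType) (S : starMonoidType) : Prop :=
  commutative (@monoid.mul S) /\
  forall psi : S -> R[i], positive_definite psi ->
    exists mu : {finite_measure set (charspace R S) -> \bar R},
      forall s : S, Cintegrable mu (hat s) /\ psi s = Cintegral mu (hat s).

(* Main.v *)
(* (i) -> (ii) is semiperfectness, (ii) -> (iii) positivity of the integral,
   and (iii) -> (iv) holds because an identity p = sum_j |q_j|^2 on a
   determining Y is an identity between the coefficients, hence holds on the
   whole character space.

   For (iv) -> (i), P(Y) is preordered, as a real vector space, by the cone of
   those p whose real part is a sum of squares. P_T(Y) is cofinal: it contains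
   1 and |hat s|^2, as T contains the Hermitian elements, and
   |b|^2 + |hat s|^2 - Re (2 b hat s) = |b^* - hat s|^2. So the M. Riesz
   extension theorem extends Re Lambda to a positive real functional g on P(Y),
   and psi s := g (hat s) - i g (i hat s) is positive definite and extends
   phi. *)

Require Import Defs.
From HB Require Import structures.
From mathcomp Require Import all_boot all_order all_algebra.
From mathcomp Require Import complex lra ring.
From mathcomp Require Import all_classical all_reals all_analysis.
Set Implicit Arguments.
Unset Strict Implicit.
Unset Printing Implicit Defensive.
Import Order.TTheory GRing.Theory Num.Theory numFieldNormedType.Exports.
Local Open Scope classical_set_scope.
Local Open Scope ring_scope.

(** * The M. Riesz extension theorem *)

(* The extension is built as a graph: since C contains 0, a linear relation on
   which u.2 >= 0 whenever u.1 \in C is automatically functional. *)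
Section RieszExtension.
Variables (R : realType) (V : lmodType R) (C : set V).
Hypothesis CD : forall x y, C x -> C y -> C (x + y).
Hypothesis CZ : forall a x, 0 <= a -> C x -> C (a *: x).

Definition pos_graph (G : set (V * R^o)) : Prop :=
  [/\ G 0, forall a u v, G u -> G v -> G (a *: u + v) &
      forall u, G u -> C u.1 -> 0 <= u.2].

(** One-dimensional extension: positivity confines the value at [x] between the values at elements
    of the domain below and above [x], and cofinality provides elements of both kinds. *)
Lemma pos_graph_step (G : set (V * R^o)) (x : V) : pos_graph G ->
  (forall y, exists2 u, G u & C (u.1 - y)) ->
  exists c : R, pos_graph [set u | exists t v, G v /\ u = v + t *: (x, c)].
Proof.
move=> [G0 GD Gpos] Gcof.
have GN u : G u -> G (- u).
  by move=> Gu; rewrite -scaleN1r -[_ *: _]addr0; exact: GD.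
have GB u v : G u -> G v -> G (u - v).
  by move=> Gu Gv; rewrite addrC -scaleN1r; exact: GD.
have GZ a u : G u -> G (a *: u) by move=> Gu; rewrite -[_ *: _]addr0; exact: GD.
(* [L] collects the lower bounds forced on the value at [x]; by [LU], each domain element above [x]
   bounds [L] from above. The value chosen is [sup L]. *)
pose L := [set a : R | exists2 e, G (e, a) & C (x - e)].
have [[e' a'] Ge' Ce'] := Gcof x.
have LU e a : G (e, a) -> C (e - x) -> ubound L a.
  move=> Ge Ce b [e1 Ge1 Ce1].
  have /= := Gpos _ (GB _ _ Ge Ge1); rewrite subr_ge0; apply.
  by rewrite -(subrK x e) -addrA; exact: CD.
have L0 : L !=set0.
  have [[e a] Ge Ce] := Gcof (- x).
  exists (- a); exists (- e); first exact: (GN _ Ge).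
  by move: Ce; rewrite /= !opprK addrC.
have supL : has_sup L by split=> //; exists a'; exact: LU Ge' Ce'.
exists (sup L); split.
- by exists 0, 0; split=> //; rewrite scale0r addr0.
- move=> a _ _ [t [u [Gu ->]]] [s [v [Gv ->]]].
  exists (a * t + s), (a *: u + v); split; first exact: GD.
  by rewrite scalerDr scalerDl scalerA addrACA.
- move=> _ [t [[e a] [Ge ->]]] /=.
  (* Dividing by [|t|] puts [-e/t] above [x] if [t < 0] and below [x] if [t > 0], so [-a/t] is an
     upper bound of [L], respectively an element of it. *)
  have [t0|t0|->] := ltgtP t 0; last by rewrite !scale0r !addr0; exact: Gpos Ge.
  + move=> /(CZ (a := (- t)^-1)); rewrite invr_ge0 oppr_ge0 => /(_ (ltW t0)).
    rewrite scalerDr scalerA invrN mulNr mulVf ?lt_eqF// scaleN1r => Cx.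
    have Gt := GZ (- t^-1) _ Ge.
    have : sup L <= - t^-1 * a by apply: ge_sup => //; exact: LU Gt Cx.
    by rewrite mulNr mulrC -mulrN -invrN ler_pdivlMr ?oppr_gt0// mulrN mulrC;
       rewrite -subr_ge0 opprK.
  + move=> /(CZ (a := t^-1)); rewrite invr_ge0 => /(_ (ltW t0)).
    rewrite scalerDr scalerA mulVf ?gt_eqF// scale1r => Cx.
    have Gt := GZ (- t^-1) _ Ge.
    have : - t^-1 * a <= sup L.
      apply: ub_le_sup; first exact: supL.2.
      by exists (- t^-1 *: e) => //; rewrite scaleNr opprK addrC.
    by rewrite mulNr mulrC -mulNr ler_pdivrMr// -subr_ge0 opprK addrC mulrC.
Qed.

(** By Zorn's lemma the graph of [f] on [E] lies in a maximal positive graph, which the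
    one-dimensional step shows to be total. *)
Theorem riesz_extension (E : set V) (f : V -> R) :
  E 0 ->
  (forall a x y, E x -> E y ->
     E (a *: x + y) /\ f (a *: x + y) = a * f x + f y) ->
  (forall x, E x -> C x -> 0 <= f x) ->
  (forall x, exists2 e, E e & C (e - x)) ->
  exists g : V -> R,
    [/\ scalar g, forall x, E x -> g x = f x & forall x, C x -> 0 <= g x].
Proof.
move=> E0 Elin fpos Ecof.
pose G0 : set (V * R^o) := [set u | E u.1 /\ u.2 = f u.1].
have f0 : f 0 = 0.
  have [_] := Elin 1 0 0 E0 E0; rewrite scaler0 mul1r addr0 => /eqP.
  by rewrite -{1}[f 0]addr0 (inj_eq (addrI _)) eq_sym => /eqP.
have G0pos : pos_graph G0.
  split=> [|a [x b] [y c] [/= Ex ->] [/= Ey ->]|[x b] [/= Ex ->]].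
  - by split.
  - by have [? fE] := Elin a _ _ Ex Ey; split.
  - exact: fpos.
(* The union with [G0] is part of the predicate because the empty chain, whose union is empty, must
   satisfy it too. *)
have [|A [Apos Amax]] := @Zorn_bigcup _ [set G | pos_graph (G0 `|` G)].
  move=> F FP Ftot.
  (* Closure under sums needs two points of the union in a single member; if both come from [G0],
     the empty set serves, since [F] may be empty. *)
  have sub2 u v : (G0 `|` \bigcup_(X in F) X) u ->
      (G0 `|` \bigcup_(X in F) X) v -> exists X, [/\ pos_graph (G0 `|` X),
      X `<=` \bigcup_(X in F) X, (G0 `|` X) u & (G0 `|` X) v].
    move=> [Gu|[X FX Xu]] [Gv|[X' FX' Xv]].
    - by exists set0; split; [rewrite setU0|exact: sub0set|left|left].
    - by exists X'; split; [exact: FP|exact: bigcup_sup|left|right].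
    - by exists X; split; [exact: FP|exact: bigcup_sup|right|left].
    - have [sXX'|sX'X] := Ftot _ _ FX FX'.
        by exists X'; split;
          [exact: FP|exact: bigcup_sup|right; exact: sXX'|right].
      by exists X; split;
        [exact: FP|exact: bigcup_sup|right|right; exact: sX'X].
  split=> [|a u v Gu Gv|u Gu].
  - by left; case: G0pos.
  - have [X [[_ XD _] sX Xu Xv]] := sub2 _ _ Gu Gv.
    by have [Gw|/sX] := XD a _ _ Xu Xv; [left|right].
  - have [X [[_ _ Xpos] _ Xu _]] := sub2 _ _ Gu Gu; exact: Xpos.
set M := G0 `|` A in Apos Amax.
have Mcof y : exists2 u, M u & C (u.1 - y).
  by have [e Ee Ce] := Ecof y; exists (e, f e) => //; left.
(* Were [x] outside the domain of [M], the one-step extension [G] would be strictly larger than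
   [M]. *)
have Mtot x : exists c, M (x, c).
  have [c cpos] := pos_graph_step x Apos Mcof; exists c; apply: contrapT => Mx.
  set G := [set u | _] in cpos.
  have MG : M `<=` G by move=> u Mu; exists 0, u; rewrite scale0r addr0.
  apply: (Amax G); last by rewrite /= setUidr// => u Gu; apply: MG; left.
  split; first by move=> u Au; apply: MG; right.
  move=> GA; apply: Mx; right; apply: GA.
  by exists 1, 0; rewrite scale1r add0r; split=> //; case: Apos.
have [M0 MD Mpos] := Apos.
have C0 : C 0.
  by have [e _ Ce] := Ecof 0; rewrite -(scale0r (e - 0)); exact: CZ.
have Mle x a b : M (x, a) -> M (x, b) -> b <= a.
  move=> Ma Mb; rewrite -subr_ge0; apply: (Mpos (0, a - b)) => //.
  have -> : (0, a - b) = -1 *: (x, b) + (x, a) :> V * R^o.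
    by rewrite scaleN1r; congr (_, _); rewrite /= addrC ?subrr.
  exact: MD.
have Mfun x a b : M (x, a) -> M (x, b) -> a = b.
  by move=> Ma Mb; apply/eqP; rewrite eq_le (Mle _ _ _ Ma Mb) (Mle _ _ _ Mb Ma).
pose g x := sval (cid (Mtot x)).
have gP x : M (x, g x) by exact: svalP (cid (Mtot x)).
exists g; split=> [a x y|x Ex|x]; last exact: Mpos (gP x).
  by apply: Mfun (gP _) _; exact: (MD a _ _ (gP x) (gP y)).
by apply: Mfun (gP x) _; left.
Qed.
End RieszExtension.

(** * Linearity and positivity of the complex integral *)

Section ComplexIntegralLinear.
Context d (X : measurableType d) (R : realType).
Variable mu : {measure set X -> \bar R}.
Implicit Types (f g : X -> R[i]) (a : R[i]).

Lemma CintegralZD a f g : Cintegrable mu f -> Cintegrable mu g ->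
  Cintegrable mu (fun x => a * f x + g x) /\
  Cintegral mu (fun x => a * f x + g x) = a * Cintegral mu f + Cintegral mu g.
Proof.
case: a => u v [Ref Imf] [Reg Img].
have ReE x : complex.Re (Complex u v * f x + g x) =
    u * complex.Re (f x) + - v * complex.Im (f x) + complex.Re (g x).
  by case: (f x) (g x) => ? ? [? ?] /=; rewrite mulNr.
have ImE x : complex.Im (Complex u v * f x + g x) =
    u * complex.Im (f x) + v * complex.Re (f x) + complex.Im (g x).
  by case: (f x) (g x) => ? ? [? ?].
have Zint (c : R) (h : X -> R) : mu.-integrable setT (EFin \o h) ->
    mu.-integrable setT (EFin \o (fun x => c * h x)).
  exact: integrableZl.
have Dint (h k : X -> R) : mu.-integrable setT (EFin \o h) ->
    mu.-integrable setT (EFin \o k) ->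
    mu.-integrable setT (EFin \o (fun x => h x + k x)).
  exact: integrableD.
split.
  split; [under eq_fun do rewrite ReE|under eq_fun do rewrite ImE].
    by apply: (Dint _ _) => //; apply: (Dint _ _); exact: (Zint _ _).
  by apply: (Dint _ _) => //; apply: (Dint _ _); exact: (Zint _ _).
rewrite /Cintegral; under [X in Complex X _]eq_Rintegral do rewrite ReE.
under [X in Complex _ X]eq_Rintegral do rewrite ImE.
rewrite !RintegralD ?RintegralZl//; do ?[exact: (Zint _ _)|apply: (Dint _ _)].
by simpc.
Qed.

Lemma Cintegral0 : Cintegrable mu (fun=> 0) /\ Cintegral mu (fun=> 0) = 0.
Proof.
split; first by split; exact: integrable0.
by rewrite /Cintegral /= /Rintegral integral0.
Qed.

Lemma Cintegral_sum I (r : seq (R[i] * I)) (f : I -> X -> R[i]) :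
  (forall i, Cintegrable mu (f i)) ->
  Cintegrable mu (fun x => \sum_(y <- r) y.1 * f y.2 x) /\
  Cintegral mu (fun x => \sum_(y <- r) y.1 * f y.2 x) =
    \sum_(y <- r) y.1 * Cintegral mu (f y.2).
Proof.
move=> fint; elim: r => [|y r [IHint IH]].
  by under eq_fun do rewrite big_nil; rewrite big_nil; exact: Cintegral0.
under eq_fun do rewrite big_cons; rewrite big_cons -IH; exact: CintegralZD.
Qed.

Lemma Cintegral_ge0 f : (forall x, 0 <= f x) -> 0 <= Cintegral mu f.
Proof.
move=> f0; rewrite /Cintegral lecE /=.
under [X in X == _]eq_Rintegral do rewrite ger0_Im//.
rewrite {1}/Rintegral integral0 eqxx /=; apply: Rintegral_ge0 => x _.
by have := f0 x; rewrite lecE => /andP[].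
Qed.

End ComplexIntegralLinear.

(** * Formal linear combinations of semigroup elements *)

Section Combinations.
Variables (R : realType) (S : starMonoidType).
Implicit Types (T : set S) (Y : set (charspace R S)) (psi : S -> R[i]).

Lemma poly_funP T Y a (p q : polyspace T Y) (chi : Y) :
  poly_fun (a *: p + q) chi = a * poly_fun p chi + poly_fun q chi.
Proof. by rewrite /poly_fun linearP. Qed.

Lemma poly_fun0 T Y (chi : Y) : poly_fun (0 : polyspace T Y) chi = 0.
Proof. by []. Qed.

Lemma poly_funZ T Y a (p : polyspace T Y) (chi : Y) :
  poly_fun (a *: p) chi = a * poly_fun p chi.
Proof. by rewrite -[a *: p]addr0 poly_funP poly_fun0 addr0. Qed.

Lemma poly_funD T Y (p q : polyspace T Y) (chi : Y) :
  poly_fun (p + q) chi = poly_fun p chi + poly_fun q chi.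
Proof. by rewrite -[p]scale1r poly_funP mul1r scale1r. Qed.

Lemma poly_funN T Y (p : polyspace T Y) (chi : Y) :
  poly_fun (- p) chi = - poly_fun p chi.
Proof. by rewrite -scaleN1r poly_funZ mulN1r. Qed.

Lemma poly_sumE T Y (r : seq (R[i] * T)) (chi : Y) :
  poly_fun (\sum_(x <- r) x.1 *: poly_hat Y x.2) chi =
  \sum_(x <- r) x.1 * hat (\val x.2) (\val chi).
Proof.
rewrite /poly_fun linear_sum fct_sumE; apply: eq_bigr => x _.
by rewrite linearZ.
Qed.

Lemma poly_ext T Y (p q : polyspace T Y) : (forall chi, p chi = q chi) -> p = q.
Proof. by move=> pq; apply/lspan_val_inj/funext => chi; exact: pq. Qed.

Lemma Lambda_sum T Y (phi : T -> R[i]) (r : seq (R[i] * T)) : determining Y ->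
  Lambda Y phi (\sum_(x <- r) x.1 *: poly_hat Y x.2) =
  \sum_(x <- r) x.1 * phi x.2.
Proof.
move=> Ydet; rewrite linear_sum; apply: eq_bigr => x _.
by rewrite linearZ /= Lambda_hat.
Qed.

(** The list stands for an element of the semigroup algebra. Pairing it with a character evaluates a
    polynomial; pairing it with an extension of [phi] evaluates the functional. *)
Definition comb (r : seq (R[i] * S)) psi := \sum_(x <- r) x.1 * psi x.2.

Lemma comb_cat r r' psi : comb (r ++ r') psi = comb r psi + comb r' psi.
Proof. exact: big_cat. Qed.

Lemma combN r psi : comb [seq (- x.1, x.2) | x <- r] psi = - comb r psi.
Proof.
by rewrite /comb big_map -sumrN; apply: eq_bigr => x _; rewrite mulNr.
Qed.

Lemma combZ a r psi : comb [seq (a * x.1, x.2) | x <- r] psi = a * comb r psi.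
Proof.
by rewrite /comb big_map mulr_sumr; apply: eq_bigr => x _; rewrite mulrA.
Qed.

Lemma comb_flatten (s : seq (seq (R[i] * S))) psi :
  comb (flatten s) psi = \sum_(r <- s) comb r psi.
Proof. by rewrite /comb big_flatten. Qed.

(** The difference of the two lists vanishes on [Y], so by linear independence its coefficients
    cancel and it pairs to zero with any [psi]. Taking a character for [psi] carries identities from
    [Y] to all characters. *)
Lemma comb_determined Y (r r' : seq (R[i] * S)) psi : determining Y ->
  (forall chi, Y chi -> comb r chi = comb r' chi) -> comb r psi = comb r' psi.
Proof.
move=> Ydet rr'; apply/eqP; rewrite -subr_eq0 -combN -comb_cat; apply/eqP.
pose inT (s : S) : [set: S] := SigSub (mem_set (I : [set: S] s)).
set r1 := r ++ _; pose rT := [seq (x.1, inT x.2) | x <- r1].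
have <- : \sum_(x <- rT) x.1 * (psi \o val) x.2 = comb r1 psi.
  by rewrite big_map.
apply: (Lambda_wd _ Ydet); apply: poly_ext => chi; rewrite poly_sumE big_map.
have := comb_cat r [seq (- x.1, x.2) | x <- r'] (val chi : character R S).
by rewrite combN rr' ?subrr//; exact: set_valP.
Qed.

(** This is the product [r^* r] in the semigroup algebra. *)
Definition sqcomb (r : seq (R[i] * S)) : seq (R[i] * S) :=
  [seq (x.1 * (y.1)^*%C, (y.2^-1 * x.2)%g) | x <- r, y <- r].

Lemma comb_sq r psi : comb (sqcomb r) psi =
  \sum_(x <- r) \sum_(y <- r) x.1 * (y.1)^*%C * psi (y.2^-1 * x.2)%g.
Proof. by rewrite /comb big_allpairs_dep. Qed.

Lemma comb_sq_char r (chi : character R S) :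
  comb (sqcomb r) chi = `|comb r chi| ^+ 2.
Proof.
rewrite comb_sq sqr_normc /comb rmorph_sum mulr_suml; apply: eq_bigr => x _.
rewrite mulr_sumr; apply: eq_bigr => y _.
by rewrite rmorphM /= charM charV [_^*%C * chi _]mulrC mulrACA.
Qed.

End Combinations.

(** * Restriction of scalars from the complex to the real numbers *)

Section Realification.
Variables (R : realType) (V : lmodType R[i]).

(** The alias carries the real module structure without clashing with the complex one on [V]. *)
Definition realified : Type := V.
HB.instance Definition _ := GRing.Zmodule.copy realified V.

Definition rscale (a : R) (v : realified) : realified := a%:C%C *: (v : V).

Lemma rscaleA a b v : rscale a (rscale b v) = rscale (a * b) v.
Proof. by rewrite /rscale scalerA -rmorphM. Qed.
Lemma rscale1 : left_id 1 rscale.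
Proof. by move=> v; rewrite /rscale rmorph1; exact: scale1r. Qed.
Lemma rscaleDr : right_distributive rscale +%R.
Proof. by move=> a v w; exact: scalerDr. Qed.
Lemma rscaleDl v : {morph rscale^~ v : a b / a + b}.
Proof. by move=> a b; rewrite /rscale rmorphD; exact: scalerDl. Qed.

HB.instance Definition _ := GRing.Zmodule_isLmodule.Build R realified
  rscaleA rscale1 rscaleDr rscaleDl.

Lemma realified_scaleE a (v : V) : a *: (v : realified) = a%:C%C *: v.
Proof. by []. Qed.

End Realification.

Local Notation hat_at chi := (fun s => hat s (\val chi)).

(** * Translation between polynomials and formal combinations *)

Section PolyComb.
Variables (R : realType) (S : starMonoidType).
Implicit Types (T : set S) (Y : set (charspace R S)) (psi : S -> R[i]).
Implicit Types (r : seq (R[i] * S)).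

Definition supported r T := forall x, x \in r -> T x.2.

(** Passing to lists allows a polynomial to be re-read in a [polyspace] with another [T] or [Y]. *)
Lemma poly_comb T Y (p : polyspace T Y) :
  exists2 r, supported r T & forall chi : Y, p chi = comb r (hat_at chi).
Proof.
have [r ->] := polyspaceE p; exists [seq (x.1, \val x.2) | x <- r].
  by move=> _ /mapP[x _ ->]; exact: set_valP.
by move=> chi; rewrite poly_sumE /comb big_map.
Qed.

Lemma comb_poly T Y r : supported r T ->
  exists p : polyspace T Y, forall chi : Y, p chi = comb r (hat_at chi).
Proof.
move=> rT.
have [r' ->] : exists r' : seq (R[i] * T), r = [seq (x.1, \val x.2) | x <- r'].
  elim: r rT => [|[a s] r IH] rT; first by exists [::].
  have [|r' ->] := IH; first by move=> x xr; apply: rT; rewrite inE xr orbT.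
  have sT : s \in T by apply/mem_set; apply: (rT (a, s)); rewrite inE eqxx.
  by exists ((a, SigSub sT) :: r').
exists (\sum_(x <- r') x.1 *: poly_hat Y x.2) => chi.
by rewrite poly_sumE /comb big_map.
Qed.

(** Any list representing [p] on [Y] will do, since on a determining set equal values force equal
    pairings with [psi]. *)
Lemma Lambda_comb T Y psi (p : polyspace T Y) r : determining Y ->
  (forall chi : Y, p chi = comb r (hat_at chi)) ->
  Lambda Y (psi \o val) p = comb r psi.
Proof.
move=> Ydet; have [r' ->] := polyspaceE p => pr; rewrite Lambda_sum//.
transitivity (comb [seq (x.1, \val x.2) | x <- r'] psi).
  by rewrite /comb big_map.
apply: (comb_determined _ Ydet) => chi Ychi.
have := pr (SigSub (mem_set Ychi)); rewrite poly_sumE => {pr} /= <-.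
by rewrite /comb big_map.
Qed.

End PolyComb.

Local Arguments conjc : simpl never.

(** * From positivity on sums of squares to a positive definite extension *)

Section Extension.
Variables (R : realType) (S : starMonoidType) (T : set S).
Variable Y : set (charspace R S).
Hypothesis Tsym : forall s, T s -> T s^-1%g.
Hypothesis Therm : forall s, s^-1%g = s -> T s.
Hypothesis Ydet : determining Y.
Variable psi : S -> R[i].
(** Condition (iv) in terms of lists; it constrains [psi] on [T] only. *)
Hypothesis psi_ge0 : forall (r : seq (R[i] * S)) (q : seq (seq (R[i] * S))),
  supported r T ->
  (forall chi : Y, comb r (hat_at chi) =
     \sum_(x <- q) `|comb x (hat_at chi)| ^+ 2) ->
  0 <= comb r psi.

Lemma comb_sq_ge0 r : supported (sqcomb r) T -> 0 <= comb (sqcomb r) psi.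
Proof.
move=> rT; apply: (psi_ge0 (q := [:: r])) => // chi.
by rewrite big_seq1; exact: comb_sq_char.
Qed.

(** Positivity on the square of [1 + a s], minus the nonnegative terms at [1] and [s^* s], makes
    [conj a * psi s^* + a * psi s] real for every [a]. *)
Lemma psi_hermitian s : T s -> psi s^-1%g = (psi s)^*%C.
Proof.
move=> Ts; have T1 : T 1%g by apply: Therm; exact: invg1.
have Tss : T (s^-1 * s)%g by apply: Therm; rewrite invgM invgK.
have h1 : 0 <= psi 1%g.
  have := @comb_sq_ge0 [:: (1, 1%g)].
  rewrite comb_sq !big_seq1 /= conjc1 !mul1r mulg1 invg1; apply.
  by move=> x; rewrite inE => /eqP -> /=; rewrite mulg1 invg1.
have hss : 0 <= psi (s^-1 * s)%g.
  have := @comb_sq_ge0 [:: (1, s)].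
  rewrite comb_sq !big_seq1 /= conjc1 !mul1r; apply.
  by move=> x; rewrite inE => /eqP ->.
have h (a : R[i]) :
    0 <= psi 1%g + a^*%C * psi s^-1%g +
         (a * psi s + a * a^*%C * psi (s^-1 * s)%g).
  have := @comb_sq_ge0 [:: (1, 1%g); (a, s)].
  rewrite comb_sq !big_cons !big_nil /= conjc1 !addr0 !mul1r mulr1 !mulg1.
  rewrite invg1 mul1g; apply.
  move=> x; rewrite !inE => /or4P[]/eqP -> /=;
    by rewrite ?invg1 ?mul1g ?mulg1//; exact: Tsym.
have {h1 hss} h1 (a : R[i]) : complex.Im (a^*%C * psi s^-1%g + a * psi s) = 0.
  have /ger0_Im := h a; have := ger0_Im h1.
  have /ger0_Im : 0 <= a * a^*%C * psi (s^-1 * s)%g.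
    by rewrite mulr_ge0// -sqr_normc exprn_ge0.
  rewrite !raddfD /= => -> ->; rewrite add0r addr0; exact.
(* a = 1 gives the imaginary parts, a = i the real parts. *)
move: (h1 1) (h1 'i%C); rewrite conjc1; case: (psi s) (psi _) => [a b] [c d].
rewrite /conjc /= => im1 imi; congr Complex; lra.
Qed.

Local Notation P := (polyspace [set: S] Y).
Let hatP s : P := poly_hat Y (SigSub (mem_set (I : [set: S] s))).

(** Only the real part is constrained, so the cone contains [p] and [-p] whenever [p] is purely
    imaginary on [Y], and a positive functional vanishes on such [p]. *)
Definition sq_cone : set (realified P) :=
  [set p | exists q : seq (seq (R[i] * S)), forall chi : Y,
     (complex.Re ((p : P) chi))%:C%C =
     \sum_(x <- q) `|comb x (hat_at chi)| ^+ 2].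

(** The image of [polyspace T Y], which is a separate type, inside [P]. *)
Definition span_T : set (realified P) :=
  [set p | exists2 r, supported r T &
     forall chi : Y, (p : P) chi = comb r (hat_at chi)].

Lemma sq_coneD p q : sq_cone p -> sq_cone q -> sq_cone (p + q).
Proof.
move=> [s ps] [t qt].
exists (s ++ t) => chi.
rewrite poly_funD big_cat /= -ps -qt -rmorphD.
by case: (poly_fun _ _) (poly_fun _ _) => ? ? [].
Qed.

Lemma sq_coneZ a p : 0 <= a -> sq_cone p -> sq_cone (a *: p).
Proof.
move=> a0 [s ps].
exists [seq [seq ((Num.sqrt a)%:C%C * y.1, y.2) | y <- x] | x <- s] => chi.
have -> : complex.Re (poly_fun (a *: p : P) chi) =
    a * complex.Re (poly_fun (p : P) chi).
  rewrite realified_scaleE poly_funZ.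
  by case: (poly_fun _ _) => u v /=; rewrite mul0r subr0.
rewrite rmorphM /= ps mulr_sumr big_map; apply: eq_bigr => x _.
rewrite combZ normrM exprMn ger0_norm ?lecR ?sqrtr_ge0//; congr (_ * _).
by rewrite -rmorphXn /= sqr_sqrtr.
Qed.

(* The factors 1 and -1 are those of the combinations in sq_cone_cofinal. *)
Lemma Re_complete_square (b z : R[i]) :
  (complex.Re (b * b^*%C * 1 + 1 * (z^*%C * z) - (b + b) * z))%:C%C =
  `|b^*%C * 1 + -1 * z| ^+ 2.
Proof.
rewrite sqr_normc !mulr1 mul1r mulN1r.
case: b z => [a b] [c d]; rewrite /conjc; simpc.
congr Complex; rewrite /=; ring.
Qed.

Lemma sq_cone_cofinal p : exists2 e, span_T e & sq_cone (e - p).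
Proof.
have [r ->] := polyspaceE p; elim: r => [|[a [s sT]] r [e [re reT eE] eC]].
  exists 0; last by exists [::] => chi; rewrite !big_nil subr0 poly_fun0.
  by exists [::] => // chi; rewrite /comb big_nil.
have T1 : T 1%g by apply: Therm; exact: invg1.
have Tss : T (s^-1 * s)%g by apply: Therm; rewrite invgM invgK.
(* Halving [a] makes the cross term of the square of [conj b - hat s] equal to the real part of
   [a * hat s]. *)
have [b ->] : exists b : R[i], a = b + b by exists (a / 2); rewrite -splitr.
have [u uE] : exists u : P, forall chi : Y, u chi =
    comb [:: (b * b^*%C, 1%g); (1, (s^-1 * s)%g)] (hat_at chi).
  by apply: comb_poly.
exists (u + e).
  exists ([:: (b * b^*%C, 1%g); (1, (s^-1 * s)%g)] ++ re).
    move=> x; rewrite mem_cat => /orP[|/reT//].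
    by rewrite !inE => /orP[]/eqP ->.
  by move=> chi; rewrite comb_cat -uE -eE.
rewrite big_cons opprD addrACA; apply: sq_coneD => //.
exists [:: [:: (b^*%C, 1%g); (-1, s)]] => chi.
rewrite big_seq1 poly_funD poly_funN poly_funZ uE.
rewrite /comb !big_cons !big_nil /= !addr0 /hat_on /hat char1 charM charV.
exact: Re_complete_square.
Qed.

Theorem positive_definite_extension : exists psi' : S -> R[i],
  positive_definite psi' /\ forall s, T s -> psi' s = psi s.
Proof.
(* [L0] lives on all of [P], but off [span_T] it depends on arbitrary values of [psi]; only its
   restriction to [span_T] is extended. *)
pose L0 : {scalar P} := Lambda Y (psi \o val).
have L0comb (p : P) r : (forall chi : Y, p chi = comb r (hat_at chi)) ->
    L0 p = comb r psi by exact: Lambda_comb.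
have [|||g [glin gT gC]] := riesz_extension sq_coneD sq_coneZ
    (E := span_T) (f := fun p => complex.Re (L0 (p : P))) _ _ _ sq_cone_cofinal.
- by exists [::] => // chi; rewrite /comb big_nil.
- move=> a p q [rp rpT pE] [rq rqT qE]; split.
    exists ([seq (a%:C%C * x.1, x.2) | x <- rp] ++ rq).
      by move=> x; rewrite mem_cat => /orP[/mapP[y /rpT ? ->]|/rqT].
    by move=> chi; rewrite comb_cat combZ -pE -qE -poly_funP.
  rewrite realified_scaleE linearP.
  by case: (L0 p) (L0 q) => ? ? [? ?] /=; rewrite mul0r subr0.
- move=> p [r rT pE] [q pq].
  (* Adding the adjoint list gives twice the real part, both at characters and at [psi]. Hence [r']
     is exactly a sum of squares, each square of [q] occurring twice, and symmetry keeps it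
     supported in [T]. *)
  pose r' := r ++ [seq ((x.1)^*%C, (x.2^-1)%g) | x <- r].
  have r'T : supported r' T.
    by move=> x; rewrite mem_cat => /orP[/rT//|/mapP[y /rT ? ->]]; exact: Tsym.
  have r'E (h : S -> R[i]) : (forall s, T s -> h s^-1%g = (h s)^*%C) ->
      comb r' h = (complex.Re (comb r h))%:C%C + (complex.Re (comb r h))%:C%C.
    move=> hh; rewrite comb_cat.
    have -> : comb [seq ((x.1)^*%C, (x.2^-1)%g) | x <- r] h = (comb r h)^*%C.
      rewrite /comb big_map rmorph_sum !big_seq; apply: eq_bigr => x /rT xT.
      by rewrite rmorphM /= hh.
    by rewrite addcJ mulr_natl mulr2n.
  rewrite (L0comb _ _ pE).
  suff : 0 <= comb r' psi.
    rewrite r'E; last exact: psi_hermitian.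
    by rewrite -rmorphD ler0c -mulr2n pmulrn_lge0.
  apply: (psi_ge0 (q := q ++ q)) => // chi.
  rewrite r'E; last by move=> s _; exact: charV.
  by rewrite -pE pq big_cat.
(* The complex linear functional whose real part is [g]. *)
pose L (p : P) := Complex (g p) (- g ('i%C *: p)).
have gE a (p q : P) : g (a%:C%C *: p + q) = a * g p + g q by exact: glin.
have g0 : g 0 = 0 by have := gE (-1) 0 0; rewrite scaler0 addr0 mulN1r addNr.
have gN (p : P) : g (- p) = - g p.
  have := gE (-1) p 0.
  by rewrite rmorphN rmorph1 scaleN1r !addr0 g0 addr0 mulN1r.
have Llin : scalar L.
  move=> [u v] p q.
  have E1 : Complex u v *: p + q = u%:C%C *: p + (v%:C%C *: ('i%C *: p) + q).
    by rewrite scalerA addrA -scalerDl; congr (_ *: _ + _); simpc.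
  have E2 : 'i%C *: (Complex u v *: p + q) =
      u%:C%C *: ('i%C *: p) + ((- v)%:C%C *: p + 'i%C *: q).
    rewrite scalerA addrA -scalerDl scalerDr scalerA; congr (_ *: _ + _).
    by simpc.
  by rewrite /L E2 E1 !gE; simpc; congr Complex; ring.
have Lcomb (p : P) r : (forall chi : Y, p chi = comb r (hat_at chi)) ->
    L p = comb r (L \o hatP).
  move=> pr; have -> : p = \sum_(x <- r) x.1 *: hatP x.2.
    apply: poly_ext => chi; rewrite pr.
    rewrite /poly_fun linear_sum fct_sumE; apply: eq_bigr => x _.
    by rewrite linearZ.
  pose LM := GRing.isLinear.Build _ _ _ _ L Llin.
  pose LL : {scalar P} := HB.pack L LM.
  rewrite -[L]/(LL : P -> R[i]) linear_sum.
  by apply: eq_bigr => x _; rewrite linearZ.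
exists (L \o hatP); split.
  move=> m s lam _; pose r := [seq (lam k, s k) | k <- enum 'I_m].
  have -> : \sum_(k < m) \sum_(l < m)
      (L \o hatP) ((s l)^-1 * s k)%g * lam k * (lam l)^*%C =
      comb (sqcomb r) (L \o hatP).
    rewrite comb_sq big_map big_enum; apply: eq_bigr => k _.
    rewrite big_map big_enum; apply: eq_bigr => l _.
    by rewrite -mulrA mulrC.
  have [p pE] : exists p : P, forall chi : Y,
      p chi = comb (sqcomb r) (hat_at chi).
    exact: comb_poly.
  have pE2 chi : p chi = `|comb r (hat_at chi)| ^+ 2.
    by rewrite pE; exact: comb_sq_char.
  have Im0 chi : complex.Im (p chi) = 0.
    by apply: ger0_Im; rewrite pE2 exprn_ge0.
  rewrite -(Lcomb p)// /L lecE /= oppr_eq0; apply/andP; split.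
    (* As [p] is real on [Y], both [i p] and [-i p] have zero real part and lie in the cone through
       the empty sum; hence [g] vanishes at [i p] and [L p] is real. *)
    have gi : 0 <= g ('i%C *: p).
      apply: gC; exists [::] => chi; rewrite big_nil.
      by rewrite poly_funZ mulrC ReiNIm Im0 oppr0.
    have gNi : 0 <= g (- ('i%C *: p)).
      apply: gC; exists [::] => chi; rewrite big_nil.
      by rewrite poly_funN poly_funZ mulrC raddfN /= ReiNIm Im0 !oppr0.
    by rewrite eq_le gi -oppr_ge0 -gN gNi.
  apply: gC; exists [:: r] => chi; rewrite big_seq1 -pE2.
  by apply: RRe_real; rewrite pE2; apply: ger0_real; rewrite exprn_ge0.
move=> s Ts.
(* The cases [a = 1] and [a = i] recover the real and imaginary parts of [psi s]. *)
have gs (a : R[i]) : g (a *: hatP s) = complex.Re (a * psi s).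
  have aE (chi : Y) :
      poly_fun (a *: hatP s) chi = comb [:: (a, s)] (hat_at chi).
    by rewrite poly_funZ /comb big_seq1.
  rewrite gT; last by exists [:: (a, s)] => // x; rewrite inE => /eqP ->.
  by rewrite (L0comb _ _ aE) /comb big_seq1.
have := gs 1; rewrite scale1r mul1r => gs1.
by rewrite /= /L gs gs1 mulrC ReiNIm opprK; case: (psi s).
Qed.

End Extension.

(** * The cycle of implications between the four conditions *)

Theorem theorem15 (R : realType) (S : starMonoidType)
    (T : set S) (Y : set (charspace R S))
    (hS : semiperfect R S)
    (hTsym : T = [set s^-1%g | s in T])
    (hTherm : [set s : S | s = s^-1%g] `<=` T)
    (hY : determining Y)
    (phi : T -> R[i]) :
  [<-> (* (i) *)
       exists psi : S -> R[i],
         positive_definite psi /\ forall s : T, psi (\val s) = phi s;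
       (* (ii) *)
       exists mu : {measure set (charspace R S) -> \bar R},
         forall s : T, Cintegrable mu (hat (\val s)) /\
                       phi s = Cintegral mu (hat (\val s));
       (* (iii) *)
       forall p : polyspace T [set: charspace R S],
         (forall chi : [set: charspace R S], 0 <= p chi) -> 0 <= Lambda [set: charspace R S] phi p;
       (* (iv) *)
       forall p : polyspace T Y,
         (exists n (q : 'I_n -> polyspace [set: S] Y),
            forall chi : Y, p chi = \sum_(j < n) `|q j chi| ^+ 2) ->
         0 <= Lambda Y phi p].
Proof.
(* Extending [phi] by zero off [T] lets it be paired with lists over [S]. *)
have [psi psiE] : exists psi : S -> R[i], phi = psi \o val.
  exists (fun s => if pselect (s \in T) is left sT then phi (SigSub sT) else 0).
  apply/funext => -[s sT] /=; case: pselect => [sT'|//].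
  by congr phi; exact: val_inj.
(* A linear relation valid on all characters restricts to [Y], where it is trivial. *)
have Xdet : determining [set: charspace R S].
  case: hY => -[xi Yxi] Yind; split; first by exists xi.
  move=> r c r_uniq cr0; apply: Yind => //; apply/funext => chi.
  pose chi' : [set: charspace R S] := SigSub (mem_set (I : setT (\val chi))).
  have /(congr1 (@^~ chi')) := cr0.
  by rewrite !fct_sumE.
split; last split; last split.
- move=> [psi' [/(proj2 hS)[mu muP] psi'E]]; exists mu => s.
  by have [? <-] := muP (\val s); split.
- move=> [mu muP] p p_ge0.
  have [r pE] := polyspaceE p; rewrite pE Lambda_sum//.
  have [_ sumE] := Cintegral_sum r (fun s => (muP s).1).
  under eq_bigr do rewrite (muP _).2.
  rewrite -sumE; apply: Cintegral_ge0 => chi.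
  have := p_ge0 (SigSub (mem_set (I : [set: charspace R S] chi))).
  by rewrite pE poly_sumE.
- move=> iii p [n [q pq]].
  have [r rT rE] := poly_comb p.
  have qr j : {x | forall chi : Y, q j chi = comb x (hat_at chi)}.
    by apply: cid; have [x _] := poly_comb (q j); exists x.
  have [p' p'E] := comb_poly setT rT.
  rewrite psiE (Lambda_comb psi hY rE) -(Lambda_comb psi Xdet p'E) -psiE.
  apply: iii => chi; rewrite p'E.
  (* The identity is known on [Y] only; [comb_determined], with the character [chi] as [psi],
     carries it to an arbitrary [chi]. *)
  have -> : comb r (hat_at chi) =
      comb (flatten [seq sqcomb (sval (qr j)) | j <- enum 'I_n]) (hat_at chi).
    apply: (comb_determined _ hY) => xi Yxi.
    have := rE (SigSub (mem_set Yxi)); rewrite pq /= => <-.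
    rewrite comb_flatten big_map big_enum; apply: eq_bigr => j _.
    rewrite (svalP (qr j)); apply/esym; exact: comb_sq_char.
  rewrite comb_flatten big_map; apply: sumr_ge0 => j _.
  have -> : comb (sqcomb (sval (qr j))) (hat_at chi) =
      `|comb (sval (qr j)) (hat_at chi)| ^+ 2.
    exact: comb_sq_char.
  by rewrite exprn_ge0.
- move=> iv.
  have [|||psi' [psi'pd psi'E]] :=
    @positive_definite_extension R S T Y _ _ hY psi.
  + by move=> s Ts; rewrite hTsym; exists s.
  + by move=> s Hs; apply: hTherm.
  + move=> r q rT rq.
    have [p pE] := comb_poly Y rT.
    rewrite -(Lambda_comb psi hY pE) -psiE; apply: iv.
    (* The default [[::]] is never reached below, where the indices stay under [size q]. *)
    have qp j : {x : polyspace [set: S] Y |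
        forall chi : Y, x chi = comb (nth [::] q j) (hat_at chi)}.
      by apply: cid; apply: comb_poly.
    exists (size q), (fun j => sval (qp j)) => chi.
    rewrite pE rq (big_nth [::]) big_mkord.
    by apply: eq_bigr => j _; rewrite (svalP (qp j)).
  + exists psi'; split=> // s; rewrite psiE /= psi'E//; exact: set_valP.
Qed.
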